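(* For any state $\rho\in B(\mathcal{H}_A\otimes\mathcal{H}_B)$ having best symmetric decomposition $\rho=\max_{\lambda}\,\lambda\,\sigma_{ext}+(1-\lambda)\,\sigma_{next}$, the best symmetric approximated entanglement monotone is defined as $$E^{ss}(\rho)=1-\lambda_{\max}(\rho).$$
   Context: A bipartite state $\rho_{AB}\in B(\mathcal{H}_A\otimes\mathcal{H}_B)$ is symmetric extendible (with respect to $B$) if there is a tripartite state $\rho_{ABE}\in B(\mathcal{H}_A\otimes\mathcal{H}_B\otimes\mathcal{H}_B)$, the third factor being called $E$, that is invariant under the permutation of the $B$ and $E$ parts, i.e. $P\rho_{ABE}P^\dagger=\rho_{ABE}$ with $P=\sum_{ijk}|ijk\rangle\langle ikj|$, and satisfies $\mathrm{Tr}_E\,\rho_{ABE}=\rho_{AB}=\rho_{AE}$. The best symmetric (extendible) decomposition, or best symmetric extendible approximation, of $\rho$ decomposes it into a symmetric extendible component $\sigma_{ext}$ and a non-symmetric extendible component $\sigma_{next}$. The notation $\rho=\max_\lambda \lambda\sigma_{ext}+(1-\lambda)\sigma_{next}$ means that the weight $\lambda$ of the symmetric extendible component is taken as large as possible. This largest weight is denoted $\lambda_{\max}(\rho)$ and called the maximum weight of extendibility of $\rho$. It satisfies $0\leq\lambda_{\max}(\rho)\leq 1$, and all symmetric extendible states have $\lambda_{\max}=1$.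
   Formalization: ''Entanglement monotone'' is taken with respect to one-way LOCC from A to B (A's instrument, then B's conditional channel); for arbitrary LOCC it fails, as B can filter Φ from the extendible ½Φ+½(I/2⊗|e⟩⟨e|). σ_next must be non-extendible only if λ≠1. *)

(* Defs.v *)
From HB Require Import structures.
From mathcomp Require Import all_boot all_order all_algebra.
From mathcomp Require Import classical_sets reals.
From mathcomp Require Import complex mxtens.

Set Implicit Arguments.
Unset Strict Implicit.
Unset Printing Implicit Defensive.

Import Order.TTheory GRing.Theory Num.Theory.
Local Open Scope classical_set_scope.
Local Open Scope complex_scope.
Local Open Scope ring_scope.

(* Conventions.  H_A = C^m and H_B = C^n; kets are column vectors.  An operator
   on H_A (x) H_B is a matrix of size m * n, the basis ket |ij> having index
   mxtens_index (i, j), so that tensor products of operators are Kronecker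
   products A *t B.  The factors of H_A (x) H_B (x) H_B associate to the left. *)

(* The conjugate transpose, A ^t* in sesquilinear_scope. *)
Definition adjmx (R : realType) p q (A : 'M[R[i]]_(p, q)) : 'M[R[i]]_(q, p) :=
  map_mx Num.conj A^T.

(* In R[i], [0 <= z] says that z is real and nonnegative, so this condition
   forces A to be Hermitian. *)
Definition psdmx (R : realType) p (A : 'M[R[i]]_p) : Prop :=
  forall v : 'cV[R[i]]_p, 0 <= (adjmx v *m A *m v) 0 0.

Definition is_state (R : realType) p (rho : 'M[R[i]]_p) : Prop :=
  psdmx rho /\ \tr rho = 1.

Definition ptrace_E (R : realType) m n (w : 'M[R[i]]_(m * n * n)) :
    'M[R[i]]_(m * n) :=
  \matrix_(x, y)
    \sum_(k < n) w (mxtens_index (x, k)) (mxtens_index (y, k)).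

Definition ptrace_B (R : realType) m n (w : 'M[R[i]]_(m * n * n)) :
    'M[R[i]]_(m * n) :=
  \matrix_(x, y) let: (a, e) := mxtens_unindex x in
                 let: (a', e') := mxtens_unindex y in
    \sum_(b < n) w (mxtens_index (mxtens_index (a, b), e))
                   (mxtens_index (mxtens_index (a', b), e')).

(* P = sum_(ijk) |ijk><ikj| *)
Definition swap_BE (R : realType) m n : 'M[R[i]]_(m * n * n) :=
  \sum_(i < m) \sum_(j < n) \sum_(k < n)
    delta_mx (mxtens_index (mxtens_index (i, j), k))
             (mxtens_index (mxtens_index (i, k), j)).

Definition sym_extendible (R : realType) m n (rho : 'M[R[i]]_(m * n)) : Prop :=
  exists w : 'M[R[i]]_(m * n * n),
    [/\ is_state w,
        swap_BE R m n *m w *m adjmx (swap_BE R m n) = w,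
        ptrace_E w = rho
      & ptrace_B w = rho].

(* The second component is required to be non-extendible only when it has
   nonzero weight: for lam = 1 the state rho is its own extendible component
   and sig_next does not occur in the decomposition. *)
Definition sym_decomposition (R : realType) m n (rho : 'M[R[i]]_(m * n))
    (lam : R) (sig_ext sig_next : 'M[R[i]]_(m * n)) : Prop :=
  [/\ 0 <= lam <= 1,
      is_state sig_ext /\ sym_extendible sig_ext,
      is_state sig_next /\ (lam != 1 -> ~ sym_extendible sig_next)
    & rho = lam%:C *: sig_ext + (1 - lam)%:C *: sig_next].

Definition best_sym_decomposition (R : realType) m n (rho : 'M[R[i]]_(m * n))
    (lam : R) (sig_ext sig_next : 'M[R[i]]_(m * n)) : Prop :=
  sym_decomposition rho lam sig_ext sig_next /\
  forall lam' sig_ext' sig_next',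
    sym_decomposition rho lam' sig_ext' sig_next' -> lam' <= lam.

Definition lambda_max (R : realType) m n (rho : 'M[R[i]]_(m * n)) : R :=
  sup [set lam : R | exists sig_ext sig_next,
                       sym_decomposition rho lam sig_ext sig_next].

Definition Ess (R : realType) m n (rho : 'M[R[i]]_(m * n)) : R :=
  1 - lambda_max rho.

Definition separable (R : realType) m n (rho : 'M[R[i]]_(m * n)) : Prop :=
  exists (N : nat) (p : 'I_N -> R)
         (alpha : 'I_N -> 'M[R[i]]_m) (beta : 'I_N -> 'M[R[i]]_n),
    [/\ forall k, 0 <= p k, \sum_k p k = 1,
        forall k, is_state (alpha k), forall k, is_state (beta k)
      & rho = \sum_k (p k)%:C *: (alpha k *t beta k)].

(* A one-way (A to B) LOCC protocol: A performs an instrument with outcomes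
   i < N, the i-th operation having Kraus operators KA i k, and sends i to B,
   who then applies the channel with Kraus operators KB i l.  That the number
   of Kraus operators does not depend on i is no restriction, since null
   operators may be added. *)
Definition one_way_LOCC (R : realType) m n m' n' N r s
    (KA : 'I_N -> 'I_r -> 'M[R[i]]_(m', m))
    (KB : 'I_N -> 'I_s -> 'M[R[i]]_(n', n)) : Prop :=
  \sum_i \sum_k adjmx (KA i k) *m KA i k = 1%:M /\
  forall i, \sum_l adjmx (KB i l) *m KB i l = 1%:M.

Definition unnormalized_output (R : realType) m n m' n' N r s
    (KA : 'I_N -> 'I_r -> 'M[R[i]]_(m', m))
    (KB : 'I_N -> 'I_s -> 'M[R[i]]_(n', n))
    (rho : 'M[R[i]]_(m * n)) (i : 'I_N) : 'M[R[i]]_(m' * n') :=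
  \sum_k \sum_l (KA i k *t KB i l) *m rho *m adjmx (KA i k *t KB i l).

Definition outcome_prob (R : realType) m n m' n' N r s
    (KA : 'I_N -> 'I_r -> 'M[R[i]]_(m', m))
    (KB : 'I_N -> 'I_s -> 'M[R[i]]_(n', n))
    (rho : 'M[R[i]]_(m * n)) (i : 'I_N) : R :=
  complex.Re (\tr (unnormalized_output KA KB rho i)).

(* An outcome of probability 0 gets the junk value 0, which has weight 0 in
   every average. *)
Definition outcome_state (R : realType) m n m' n' N r s
    (KA : 'I_N -> 'I_r -> 'M[R[i]]_(m', m))
    (KB : 'I_N -> 'I_s -> 'M[R[i]]_(n', n))
    (rho : 'M[R[i]]_(m * n)) (i : 'I_N) : 'M[R[i]]_(m' * n') :=
  ((outcome_prob KA KB rho i)^-1)%:C *: unnormalized_output KA KB rho i.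

(* Vidal's conditions, with LOCC restricted to one-way communication from A to
   B, the class of operations matching extendibility with respect to B:
   extendible states are not preserved when B communicates his outcomes (the
   qubit-qutrit state 1/2 Phi + 1/2 (I/2 (x) |e><e|) is extendible, and B can
   filter Phi out of it).  The monotone is a family of functions indexed by the
   dimensions, and a protocol may change the dimensions. *)
Definition one_way_entanglement_monotone (R : realType)
    (E : forall m n : nat, 'M[R[i]]_(m * n) -> R) : Prop :=
  [/\ forall m n (rho : 'M[R[i]]_(m * n)), is_state rho -> 0 <= E m n rho,
      forall m n (rho : 'M[R[i]]_(m * n)), separable rho -> E m n rho = 0,
      forall m n (rho : 'M[R[i]]_(m * n)) (U : 'M[R[i]]_m) (V : 'M[R[i]]_n),
        is_state rho -> U \is unitarymx -> V \is unitarymx ->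
        E m n ((U *t V) *m rho *m adjmx (U *t V)) = E m n rho,
      forall m n m' n' N r s
          (KA : 'I_N -> 'I_r -> 'M[R[i]]_(m', m))
          (KB : 'I_N -> 'I_s -> 'M[R[i]]_(n', n)) (rho : 'M[R[i]]_(m * n)),
        is_state rho -> one_way_LOCC KA KB ->
        \sum_i outcome_prob KA KB rho i * E m' n' (outcome_state KA KB rho i)
          <= E m n rho
    & forall m n N (p : 'I_N -> R) (rho : 'I_N -> 'M[R[i]]_(m * n)),
        (forall k, 0 <= p k) -> \sum_k p k = 1 ->
        (forall k, is_state (rho k)) ->
        E m n (\sum_k (p k)%:C *: rho k) <= \sum_k p k * E m n (rho k)].

(* Main.v *)
Require Import Defs.
From mathcomp Require Import all_boot all_order all_algebra.
From mathcomp Require Import classical_sets reals.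
From mathcomp Require Import complex mxtens.
From mathcomp Require Import boolp topology normedtype derive ring.

Set Implicit Arguments.
Unset Strict Implicit.
Unset Printing Implicit Defensive.

Import Order.TTheory GRing.Theory Num.Theory.
Import numFieldTopology.Exports numFieldNormedType.Exports.
Local Open Scope sesquilinear_scope.
Local Open Scope complex_scope.
Local Open Scope ring_scope.

(* The maximal weight of an extendible component is the value of a semidefinite
   program: maximise tr w over the positive, swap-invariant w on A (x) B (x) E
   with Tr_E w <= rho.  The feasible set is compact, so the maximum is attained;
   if it is less than 1, the remainder is not extendible, since otherwise its
   extension could be added to w.  The program is convex and homogeneous in rho,
   which gives the convexity of Ess, and a separable state is feasible with
   weight 1 through sum p_k alpha_k (x) beta_k (x) beta_k.  A one-way protocol
   acts on a feasible w by letting B and E both apply B's channel for the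
   message received: the partial traces of the results are feasible for the
   outcomes and their traces add up to tr w.  Invariance under local unitaries
   is the case of a protocol with a single outcome, applied in both
   directions. *)

(** * Algebra of the conjugate transpose, Kronecker products and the trace pairing *)

Section Adjoint.
Variable R : realType.
Notation C := R[i].

Lemma adjmxM p q r (A : 'M[C]_(p, q)) (B : 'M[C]_(q, r)) :
  adjmx (A *m B) = adjmx B *m adjmx A.
Proof. by rewrite /adjmx trmx_mul map_mxM. Qed.

Lemma adjmxK p q : cancel (@adjmx R p q) (@adjmx R q p).
Proof. by move=> A; apply/matrixP => x y; rewrite !mxE conjCK. Qed.

Lemma adjmxD p q (A B : 'M[C]_(p, q)) : adjmx (A + B) = adjmx A + adjmx B.
Proof. by apply/matrixP => x y; rewrite !mxE rmorphD. Qed.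

Lemma adjmxZ p q (c : C) (A : 'M[C]_(p, q)) :
  adjmx (c *: A) = Num.conj c *: adjmx A.
Proof. by apply/matrixP => x y; rewrite !mxE rmorphM. Qed.

Lemma adjmx1 p : adjmx (1%:M : 'M[C]_p) = 1%:M.
Proof. by rewrite /adjmx trmx1 map_mx1. Qed.

Lemma adjmx_delta p q x y : adjmx (delta_mx x y : 'M[C]_(p, q)) = delta_mx y x.
Proof. by rewrite /adjmx trmx_delta map_delta_mx. Qed.

Lemma adjmx_tens m n p q (A : 'M[C]_(m, n)) (B : 'M[C]_(p, q)) :
  adjmx (A *t B) = adjmx A *t adjmx B.
Proof. by rewrite /adjmx trmx_tens map_mxT. Qed.

Lemma tensmx11 m n : (1%:M : 'M[C]_m) *t (1%:M : 'M[C]_n) = 1%:M.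
Proof.
apply/matrixP => x y; case: (mxtens_indexP x) => a b.
case: (mxtens_indexP y) => a' b'; rewrite tensmxE !mxE -natrM mulnb.
by rewrite (can_eq (@mxtens_indexK _ _)) xpair_eqE.
Qed.

Lemma tensmx_suml (I : finType) m n p q (A : I -> 'M[C]_(m, n))
    (D : 'M[C]_(p, q)) : (\sum_i A i) *t D = \sum_i A i *t D.
Proof.
by apply/matrixP => x y; rewrite mxE !summxE mulr_suml; apply: eq_bigr => i _; rewrite mxE.
Qed.

Lemma tensmx_sumr (I : finType) m n p q (D : 'M[C]_(m, n))
    (A : I -> 'M[C]_(p, q)) : D *t (\sum_i A i) = \sum_i D *t A i.
Proof.
by apply/matrixP => x y; rewrite mxE !summxE mulr_sumr; apply: eq_bigr => i _; rewrite mxE.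
Qed.

Lemma mxtrace_tens m n (A : 'M[C]_m) (B : 'M[C]_n) :
  \tr (A *t B) = \tr A * \tr B.
Proof.
rewrite /mxtrace mulr_sum; apply: eq_bigr => x _.
by rewrite mxE.
Qed.

Lemma mxtrace_delta_mul p q (A : 'M[C]_(p, q)) x y :
  \tr (delta_mx y x *m A) = A x y.
Proof.
rewrite mxtrace_mulC /mxtrace (bigD1 x) //= big1 => [|z /negPf zx].
  by rewrite addr0 mxE (bigD1 y) //= big1 => [|t /negPf ty];
    rewrite !mxE ?ty ?andbF ?eqxx ?mulr0 // mulr1 addr0.
by rewrite mxE big1 // => t _; rewrite !mxE zx andbF mulr0.
Qed.

(** Nondegeneracy of the trace pairing, tested on matrix units. It allows identities of partial
    traces to be proved through the adjoint map. *)
Lemma mx_trace_inj p q (A B : 'M[C]_(p, q)) :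
  (forall X : 'M[C]_(q, p), \tr (X *m A) = \tr (X *m B)) -> A = B.
Proof. by move=> AB; apply/matrixP => x y; rewrite -!mxtrace_delta_mul. Qed.

End Adjoint.

(** * Positive semidefinite matrices: closure properties, entry bounds, Gram form *)

Section Positive.
Variable R : realType.
Notation C := R[i].

(** Positivity as a family of conditions linear in [A], the form suited to [ptrace_E_adjoint] and to
    closedness. *)
Lemma psdmxP p (A : 'M[C]_p) :
  psdmx A <-> forall v : 'cV[C]_p, 0 <= \tr (v *m adjmx v *m A).
Proof.
suff E (v : 'cV_p) : (adjmx v *m A *m v) 0 0 = \tr (v *m adjmx v *m A).
  by split=> A0 v; move: (A0 v); rewrite E.
by rewrite -[LHS]trace_mx11 mxtrace_mulC !mulmxA.
Qed.

Lemma psdmx_congr p q (B : 'M[C]_(q, p)) (A : 'M[C]_p) :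
  psdmx A -> psdmx (B *m A *m adjmx B).
Proof.
by move=> A0 v; move: (A0 (adjmx B *m v)); rewrite adjmxM adjmxK !mulmxA.
Qed.

Lemma psdmxD p (A B : 'M[C]_p) : psdmx A -> psdmx B -> psdmx (A + B).
Proof.
by move=> A0 B0 v; rewrite mulmxDr mulmxDl mxE addr_ge0.
Qed.

Lemma psdmx0 p : psdmx (0 : 'M[C]_p).
Proof. by move=> v; rewrite mulmx0 mul0mx mxE. Qed.

Lemma psdmx_sum (I : finType) p (A : I -> 'M[C]_p) :
  (forall i, psdmx (A i)) -> psdmx (\sum_i A i).
Proof.
by move=> A0 v; rewrite mulmx_sumr mulmx_suml summxE sumr_ge0 // => i _; exact: A0.
Qed.

Lemma psdmxZ p (c : C) (A : 'M[C]_p) : 0 <= c -> psdmx A -> psdmx (c *: A).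
Proof.
by move=> c0 A0 v; rewrite -scalemxAr -scalemxAl mxE mulr_ge0.
Qed.

Lemma psdmx1 p : psdmx (1%:M : 'M[C]_p).
Proof.
move=> v; rewrite mulmx1 mxE sumr_ge0 // => x _.
by rewrite !mxE mulrC mul_conjC_ge0.
Qed.

Lemma psdmx_gram p q (B : 'M[C]_(q, p)) : psdmx (B *m adjmx B).
Proof. by rewrite -[B in B *m _]mulmx1; apply/psdmx_congr/psdmx1. Qed.

Lemma psdmx_diag_ge0 p (A : 'M[C]_p) x : psdmx A -> 0 <= A x x.
Proof.
move=> /(_ (delta_mx x 0)).
by rewrite adjmx_delta -rowE -colE !mxE.
Qed.

Lemma psdmx_trace_ge0 p (A : 'M[C]_p) : psdmx A -> 0 <= \tr A.
Proof. by move=> A0; apply: sumr_ge0 => x _; exact: psdmx_diag_ge0. Qed.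

(** The quadratic form at the vector e_x + c e_y. Suitable choices of [c] extract information on the
    off-diagonal entries. *)
Lemma psdmx_form2 p (A : 'M[C]_p) x y (c : C) : psdmx A ->
  0 <= A x x + c * A x y + Num.conj c * A y x + `|c| ^+ 2 * A y y.
Proof.
move=> /(_ (delta_mx x 0 + c *: delta_mx y 0)).
rewrite adjmxD adjmxZ !adjmx_delta !mulmxDl !mulmxDr -!scalemxAl -!scalemxAr.
by rewrite -!rowE -!colE !mxE normCKC addrACA mulrA -!addrA; congr (0 <= _ + _); ring.
Qed.

(** Polarisation: the form is real at c = 1 and at c = i, and these two conditions determine [A y x]
    from [A x y]. *)
Lemma psdmx_conj p (A : 'M[C]_p) x y : psdmx A -> A y x = Num.conj (A x y).
Proof.
move=> A0.
have real_conj (z : C) : 0 <= z -> Num.conj z = z.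
  by move=> z0; apply/CrealP; apply: ger0_real.
have dx := real_conj _ (psdmx_diag_ge0 x A0).
have dy := real_conj _ (psdmx_diag_ge0 y A0).
have := real_conj _ (psdmx_form2 x y 1 A0).
have := real_conj _ (psdmx_form2 x y 'i%R A0).
rewrite normCi normr1 !expr1n !rmorphD !rmorphM /= !conjCK conjCi !rmorph1 dx dy.
rewrite !mul1r; set a := A x y; set b := A y x; set i := 'i%R => K1 K2.
apply/eqP; rewrite eq_sym -subr_eq0 -(mulrI_eq0 _ (lregP (_ : 2 != 0))) ?pnatr_eq0 //.
move/eqP: K1; rewrite -subr_eq0 => /eqP K1; move/eqP: K2; rewrite -subr_eq0 => /eqP K2.
have i2 : i * i + 1 = 0 by rewrite -expr2 sqrCi addNr.
(* [i * K1 + K2] isolates [2 (conj a - b)]. *)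
have <- : i * 0 + 0 + 0 * (Num.conj a - Num.conj b + a - b) = 0.
  by rewrite mulr0 mul0r !addr0.
by rewrite -{1}K1 -{1}K2 -{1}i2; apply/eqP; ring.
Qed.

(** Positivity on the span of e_x and e_y gives 2 |A x y| <= A x x + A y y. The bound makes the
    feasible set bounded. *)
Lemma psdmx_norm_le_trace p (A : 'M[C]_p) x y : psdmx A -> `|A x y| <= \tr A.
Proof.
move=> A0; have diag_le z : A z z <= \tr A.
  by rewrite /mxtrace (bigD1 z) //= lerDl sumr_ge0 // => t _; exact: psdmx_diag_ge0.
have [->|a0] := eqVneq (A x y) 0.
  by rewrite normr0 psdmx_trace_ge0.
have na0 : `|A x y| != 0 by rewrite normr_eq0.
(* This phase turns each of the two cross terms into - |A x y|. *)
have := psdmx_form2 x y (- (Num.conj (A x y) / `|A x y|)) A0.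
rewrite (psdmx_conj x y A0) -rmorphM.
have -> : - (Num.conj (A x y) / `|A x y|) * A x y = - `|A x y|.
  by rewrite mulNr mulrAC [Num.conj _ * _]mulrC -normCK expr2 mulfK.
have -> : `| - (Num.conj (A x y) / `|A x y|)| = 1.
  by rewrite normrN normrM norm_conjC normrV ?unitfE // normr_id divff.
rewrite rmorphN /= conj_Creal ?normr_real // expr1n mul1r => H.
rewrite -(ler_pMn2r (ltn0Sn 1)) !mulr2n.
apply: le_trans (lerD (diag_le x) (diag_le y)); rewrite -subr_ge0.
by apply: le_trans H _; rewrite le_eqVlt; apply/orP; left; apply/eqP; ring.
Qed.

Lemma psdmx_trace0 p (A : 'M[C]_p) : psdmx A -> \tr A = 0 -> A = 0.
Proof.
move=> A0 tA; apply/matrixP => x y; apply/eqP; rewrite mxE -normr_le0 -tA.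
exact: psdmx_norm_le_trace.
Qed.

(** Spectral theorem, then square roots of the eigenvalues. The Gram form makes positivity of tensor
    products immediate. *)
Lemma psdmx_gramE p (A : 'M[C]_p) : psdmx A -> exists B : 'M[C]_p, A = B *m adjmx B.
Proof.
move=> A0; have hA : adjmx A = A.
  by apply/matrixP => x y; rewrite !mxE -psdmx_conj.
have [P [d [PP AE]]] : exists P : 'M[C]_p, exists d : 'rV[C]_p,
    P *m adjmx P = 1%:M /\ A = adjmx P *m diag_mx d *m P.
  have /orthomx_spectralP AE : A \is normalmx.
    by apply/normalmxP; rewrite -[_ ^t*]/(adjmx A) hA.
  exists (spectralmx A), (spectral_diag A); split.
    exact/unitarymxP/spectral_unitarymx.
  by rewrite {1}AE invmx_unitary ?spectral_unitarymx.
(* The eigenvalues are the diagonal entries of the positive matrix P A P^*. *)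
have d0 x : 0 <= d 0 x.
  have := psdmx_diag_ge0 x (psdmx_congr P A0).
  by rewrite AE !mulmxA PP mul1mx -mulmxA PP mulmx1 mxE eqxx.
pose s := \row_x sqrtC (d 0 x); exists (adjmx P *m diag_mx s).
have -> : A = adjmx P *m (diag_mx s *m adjmx (diag_mx s)) *m P.
  rewrite AE; congr (_ *m _ *m _).
  rewrite /adjmx tr_diag_mx map_diag_mx mulmx_diag; congr diag_mx.
  by apply/rowP => x; rewrite !mxE -normCK ger0_norm ?sqrtC_ge0 // sqrtCK.
by rewrite adjmxM adjmxK !mulmxA.
Qed.

Lemma psdmx_tens m n (A : 'M[C]_m) (B : 'M[C]_n) :
  psdmx A -> psdmx B -> psdmx (A *t B).
Proof.
move=> /psdmx_gramE[A' ->] /psdmx_gramE[B' ->].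
by rewrite -tensmx_mul -adjmx_tens; exact: psdmx_gram.
Qed.

End Positive.

(** * The partial trace over E and the swap of B and E *)

Section PartialTrace.
Variable R : realType.
Notation C := R[i].

Lemma sum_mxtens_index (V : nmodType) m n (F : 'I_(m * n) -> V) :
  \sum_x F x = \sum_(a < m) \sum_(b < n) F (mxtens_index (a, b)).
Proof.
rewrite pair_bigA /=; apply: reindex.
by exists (@mxtens_unindex m n) => x _; rewrite ?mxtens_indexK ?mxtens_unindexK //;
  case: x.
Qed.

(** The partial trace is the adjoint of tensoring with the identity. With [mx_trace_inj], this
    replaces index computations by Kronecker algebra. *)
Lemma ptrace_E_adjoint m n (X : 'M[C]_(m * n)) (w : 'M[C]_(m * n * n)) :
  \tr (X *m ptrace_E w) = \tr ((X *t 1%:M) *m w).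
Proof.
rewrite /mxtrace [RHS]sum_mxtens_index; apply: eq_bigr => x _.
rewrite mxE; under eq_bigr => y _ do rewrite mxE mulr_sumr.
rewrite exchange_big /=; apply: eq_bigr => k _.
rewrite mxE [RHS]sum_mxtens_index; apply: eq_bigr => y _.
rewrite (bigD1 k) //= tensmxE mxE eqxx mulr1 big1 ?addr0 // => l lk.
by rewrite tensmxE mxE eq_sym (negPf lk) mulr0 mul0r.
Qed.

Lemma mxtrace_ptrace_E m n (w : 'M[C]_(m * n * n)) : \tr (ptrace_E w) = \tr w.
Proof. by rewrite -[ptrace_E w]mul1mx ptrace_E_adjoint tensmx11 mul1mx. Qed.

Lemma ptrace_ED m n (v w : 'M[C]_(m * n * n)) :
  ptrace_E (v + w) = ptrace_E v + ptrace_E w.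
Proof.
by apply: mx_trace_inj => X; rewrite mulmxDr mxtraceD !ptrace_E_adjoint mulmxDr mxtraceD.
Qed.

Lemma ptrace_E0 m n : ptrace_E (0 : 'M[C]_(m * n * n)) = 0.
Proof. by apply: mx_trace_inj => X; rewrite ptrace_E_adjoint !mulmx0 !mxtrace0. Qed.

Lemma ptrace_EZ m n (c : C) (w : 'M[C]_(m * n * n)) :
  ptrace_E (c *: w) = c *: ptrace_E w.
Proof.
by apply: mx_trace_inj => X; rewrite ptrace_E_adjoint -!scalemxAr !mxtraceZ ptrace_E_adjoint.
Qed.

Lemma ptrace_E_sum (I : finType) m n (w : I -> 'M[C]_(m * n * n)) :
  ptrace_E (\sum_i w i) = \sum_i ptrace_E (w i).
Proof.
by apply: (big_morph (@ptrace_E R m n)); [exact: ptrace_ED | exact: ptrace_E0].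
Qed.

Lemma ptrace_E_tens m n (A : 'M[C]_(m * n)) (B : 'M[C]_n) :
  ptrace_E (A *t B) = \tr B *: A.
Proof.
apply: mx_trace_inj => X.
by rewrite ptrace_E_adjoint tensmx_mul mul1mx mxtrace_tens -scalemxAr mxtraceZ mulrC.
Qed.

Lemma psdmx_ptrace_E m n (w : 'M[C]_(m * n * n)) : psdmx w -> psdmx (ptrace_E w).
Proof.
move=> w0; apply/psdmxP => v; rewrite ptrace_E_adjoint.
(* Since vv^* (x) 1 = K^* K, the pairing becomes the trace of the positive matrix K w K^*. *)
pose K := adjmx v *t (1%:M : 'M[C]_n).
have -> : (v *m adjmx v) *t 1%:M = adjmx K *m K.
  by rewrite adjmx_tens adjmxK adjmx1 tensmx_mul mulmx1.
rewrite -mulmxA mxtrace_mulC.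
exact/psdmx_trace_ge0/psdmx_congr.
Qed.

(** A channel on E alone is invisible once E is traced out: by cyclicity its Kraus operators
    recombine into the identity. *)
Lemma ptrace_E_kraus (I : finType) m n m' n' (M : 'M[C]_(m' * n', m * n))
    (N : I -> 'M[C]_(n', n)) (w : 'M[C]_(m * n * n)) :
  \sum_i adjmx (N i) *m N i = 1%:M ->
  \sum_i ptrace_E ((M *t N i) *m w *m adjmx (M *t N i)) = M *m ptrace_E w *m adjmx M.
Proof.
move=> N1; rewrite -ptrace_E_sum; apply: mx_trace_inj => X.
rewrite ptrace_E_adjoint mulmx_sumr raddf_sum /=.
rewrite mulmxA mxtrace_mulC !mulmxA ptrace_E_adjoint -N1 tensmx_sumr mulmx_suml raddf_sum /=.
apply: eq_bigr => i _.
by rewrite mulmxA mxtrace_mulC !mulmxA adjmx_tens !tensmx_mul mulmx1.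
Qed.

(** The permutation of basis indices underlying [swap_BE], which reduces conjugation by [swap_BE] to
    reindexing. *)
Definition swap_index m n (x : 'I_(m * n * n)) : 'I_(m * n * n) :=
  let: (ab, e) := mxtens_unindex x in
  let: (a, b) := mxtens_unindex ab in
  mxtens_index (mxtens_index (a, e), b).

Lemma swap_indexE m n (a : 'I_m) (b e : 'I_n) :
  swap_index (mxtens_index (mxtens_index (a, b), e)) =
  mxtens_index (mxtens_index (a, e), b).
Proof. by rewrite /swap_index !mxtens_indexK. Qed.

(** A view for case analysis that splits an index into its A, B and E coordinates. *)
Variant triple_index m n : 'I_(m * n * n) -> Prop :=
  TripleIndex a b e : triple_index (mxtens_index (mxtens_index (a, b), e)).

Lemma triple_indexP m n (x : 'I_(m * n * n)) : triple_index x.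
Proof. by case: (mxtens_indexP x) => ab e; case: (mxtens_indexP ab) => a b. Qed.

Lemma swap_indexK m n : involutive (@swap_index m n).
Proof. by move=> x; case: (triple_indexP x) => a b e; rewrite !swap_indexE. Qed.

Lemma swap_BEE m n x y : swap_BE R m n x y = (y == swap_index x)%:R.
Proof.
case: (triple_indexP x) => a b e; rewrite swap_indexE summxE (bigD1 a) //= summxE.
rewrite (bigD1 b) //= summxE (bigD1 e) //= mxE eqxx /=.
have ieq (p q : nat) (u v : 'I_p * 'I_q) : (mxtens_index u == mxtens_index v) = (u == v).
  exact: can_eq (@mxtens_indexK _ _) _ _.
rewrite !big1 ?addr0 // => [i ia|j jb|k ke].
- rewrite summxE big1 // => j _; rewrite summxE big1 // => k _.
  by rewrite mxE !ieq /= !xpair_eqE !ieq !xpair_eqE eq_sym (negPf ia).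
- rewrite summxE big1 // => k _.
  by rewrite mxE !ieq /= !xpair_eqE !ieq !xpair_eqE [b == _]eq_sym (negPf jb) andbF.
- by rewrite mxE !ieq /= !xpair_eqE !ieq !xpair_eqE [e == _]eq_sym (negPf ke) !andbF.
Qed.

Lemma swap_BE_mulE m n p (w : 'M[C]_(m * n * n, p)) x y :
  (swap_BE R m n *m w) x y = w (swap_index x) y.
Proof.
rewrite mxE (bigD1 (swap_index x)) //= swap_BEE eqxx mul1r big1 ?addr0 // => z.
by rewrite swap_BEE => /negPf ->; rewrite mul0r.
Qed.

Lemma swap_BE_conjE m n (w : 'M[C]_(m * n * n)) x y :
  (swap_BE R m n *m w *m adjmx (swap_BE R m n)) x y =
  w (swap_index x) (swap_index y).
Proof.
rewrite -mulmxA swap_BE_mulE mxE (bigD1 (swap_index y)) //=.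
rewrite 2!mxE swap_BEE eqxx conjC1 mulr1 big1 ?addr0 // => z /negPf zy.
by rewrite 2!mxE swap_BEE zy conjC0 mulr0.
Qed.

Definition swap_inv m n (w : 'M[C]_(m * n * n)) :=
  swap_BE R m n *m w *m adjmx (swap_BE R m n) = w.

Lemma swap_invP m n (w : 'M[C]_(m * n * n)) :
  swap_inv w <-> forall x y, w (swap_index x) (swap_index y) = w x y.
Proof.
split=> [sw x y|sw]; first by rewrite -[in RHS]sw swap_BE_conjE.
by apply/matrixP => x y; rewrite swap_BE_conjE.
Qed.

(** The swap carries the sum over B to the sum over E. This supplies the second marginal condition
    of [sym_extendible]. *)
Lemma ptrace_B_swap_inv m n (w : 'M[C]_(m * n * n)) :
  swap_inv w -> ptrace_B w = ptrace_E w.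
Proof.
move=> /swap_invP sw; apply/matrixP => x y.
case: (mxtens_indexP x) => a b; case: (mxtens_indexP y) => a' b'.
rewrite !mxE !mxtens_indexK; apply: eq_bigr => k _.
by rewrite -sw !swap_indexE.
Qed.

Lemma swap_invD m n (v w : 'M[C]_(m * n * n)) :
  swap_inv v -> swap_inv w -> swap_inv (v + w).
Proof. by rewrite /swap_inv mulmxDr mulmxDl => -> ->. Qed.

Lemma swap_invZ m n (c : C) (w : 'M[C]_(m * n * n)) :
  swap_inv w -> swap_inv (c *: w).
Proof. by rewrite /swap_inv -scalemxAr -scalemxAl => ->. Qed.

Lemma swap_inv_sum (I : finType) m n (w : I -> 'M[C]_(m * n * n)) :
  (forall i, swap_inv (w i)) -> swap_inv (\sum_i w i).
Proof.
move=> sw; rewrite /swap_inv mulmx_sumr mulmx_suml.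
by apply: eq_bigr => i _; exact: sw.
Qed.

Lemma swap_BE_tens m n m' n' (A : 'M[C]_(m', m)) (B B' : 'M[C]_(n', n)) :
  swap_BE R m' n' *m (A *t B *t B') = (A *t B' *t B) *m swap_BE R m n.
Proof.
apply/matrixP => x y; rewrite swap_BE_mulE [RHS]mxE.
rewrite (bigD1 (swap_index y)) //= swap_BEE swap_indexK eqxx mulr1.
rewrite big1 ?addr0 => [|z zy]; last first.
  by rewrite swap_BEE -(can2_eq (@swap_indexK _ _) (@swap_indexK _ _)) eq_sym (negPf zy) mulr0.
case: (triple_indexP x) => a b e; case: (triple_indexP y) => a' b' e'.
by rewrite !swap_indexE !tensmxE mulrAC.
Qed.

(** Conjugation by the swap sends the term of index (i, j) to that of index (j, i), and the double
    sum is symmetric under this exchange. *)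
Lemma swap_inv_kraus (I : finType) m n m' n' (A : 'M[C]_(m', m))
    (B : I -> 'M[C]_(n', n)) (w : 'M[C]_(m * n * n)) : swap_inv w ->
  swap_inv (\sum_i \sum_j (A *t B i *t B j) *m w *m adjmx (A *t B i *t B j)).
Proof.
move=> sw; rewrite /swap_inv mulmx_sumr mulmx_suml exchange_big /=.
under eq_bigr => i _ do rewrite mulmx_sumr mulmx_suml.
apply: eq_bigr => i _; apply: eq_bigr => j _.
rewrite !mulmxA swap_BE_tens -[LHS]mulmxA -adjmxM swap_BE_tens adjmxM !mulmxA.
by rewrite -!mulmxA [swap_BE _ _ _ *m (w *m _)]mulmxA [_ *m w *m _]mulmxA sw.
Qed.

End PartialTrace.

(** * Maximising the trace over a closed bounded set of complex matrices *)

Section Compactness.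
Variable R : realType.
Notation C := R[i].
Local Open Scope classical_set_scope.

Notation coord p := (bool * ('I_p * 'I_p))%type.

(** Complex matrices in real coordinates, the tag [false] marking real parts and [true] imaginary
    parts, so that compactness of real boxes applies. *)
Definition mx_of_coords p (v : 'rV[R]_#|{: coord p}|) : 'M[C]_p :=
  \matrix_(x, y) (v 0 (enum_rank (false, (x, y))) +i* v 0 (enum_rank (true, (x, y)))).

Lemma mx_of_coords_onto p (w : 'M[C]_p) : (forall x y, `|w x y| <= 1) ->
  exists2 v, mx_of_coords v = w & forall k, `|v 0 k| <= 1.
Proof.
move=> w1.
exists (\row_k let: (b, (x, y)) := enum_val k in
               if b then complex.Im (w x y) else complex.Re (w x y)).
  by apply/matrixP => x y; rewrite !mxE !enum_rankK; case: (w x y).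
move=> k; rewrite mxE; case: (enum_val k) => [[] [x y]]; rewrite -lecR.
  (* Multiplication by i reduces the bound on the imaginary part to that on the real part. *)
  have := normc_ge_Re (w x y * 'i%C); rewrite ReiNIm normrN normrM.
  by rewrite [`|'i%C|]normc_def /= expr0n expr1n add0r sqrtr1 mulr1 => /le_trans; apply.
by apply: le_trans (w1 x y); exact: normc_ge_Re.
Qed.

Lemma continuous_coord_sum p (F : 'I_p -> 'I_p -> 'rV[R]_#|{: coord p}| -> R) :
  (forall x y, continuous (F x y)) ->
  continuous (fun v => \sum_x \sum_y F x y v).
Proof.
move=> cF.
do 2 (apply: continuous_big => [|? _]; first exact: add_continuous).
exact: cF.
Qed.

Lemma continuous_mxtrace p (T : 'M[C]_p) :
  continuous (fun v => complex.Re (\tr (T *m mx_of_coords v))) /\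
  continuous (fun v => complex.Im (\tr (T *m mx_of_coords v))).
Proof.
(* The indices are transposed because [T x y] is paired with the entry at (y, x) in the trace of the
   product. *)
pose re x y (v : 'rV[R]_#|{: coord p}|) := v 0 (enum_rank (false, (y, x))).
pose im x y (v : 'rV[R]_#|{: coord p}|) := v 0 (enum_rank (true, (y, x))).
have trE v : \tr (T *m @mx_of_coords p v) =
  (\sum_x \sum_y (complex.Re (T x y) * re x y v + - complex.Im (T x y) * im x y v))
  +i* (\sum_x \sum_y (complex.Im (T x y) * re x y v + complex.Re (T x y) * im x y v)).
  rewrite /mxtrace; under eq_bigr do rewrite mxE.
  apply/eqP; rewrite eq_complex /=; apply/andP.
  split; apply/eqP; rewrite raddf_sum; apply: eq_bigr => x _; rewrite raddf_sum;
    apply: eq_bigr => y _; rewrite mxE; by case: (T x y) => s t /=; rewrite ?mulNr // addrC.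
have ck (k : R) i : continuous (fun v : 'rV[R]_#|{: coord p}| => k * v 0 i).
  move=> v; apply: (@continuousM _ _ (fun=> k) (fun v : 'rV[R]__ => v 0 i)).
    exact: cst_continuous.
  exact: coord_continuous.
have creim (s t : R) x y : continuous (fun v => s * re x y v + t * im x y v).
  move=> v; apply: (@continuousD _ _ _ (fun v => s * re x y v) (fun v => t * im x y v));
    exact: ck.
split; under [X in continuous X]funext do rewrite trE /=;
  by apply: continuous_coord_sum => x y; exact: creim.
Qed.

(** In the order on [R[i]] the condition is an equality of imaginary parts and an inequality of real
    parts, both closed. *)
Lemma closed_mxtrace_ge p (T : 'M[C]_p) (c : C) :
  closed [set v | c <= \tr (T *m mx_of_coords v)].
Proof.
have [cRe cIm] := continuous_mxtrace T.
rewrite (_ : mkset _ =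
    ((fun v => complex.Im (\tr (T *m mx_of_coords v))) @^-1` [set s | s = complex.Im c]) `&`
    ((fun v => complex.Re (\tr (T *m mx_of_coords v))) @^-1` [set s | complex.Re c <= s])).
  apply: closedI.
    exact: (continuous_closedP _).1 cIm _ (@closed_eq _ _).
  exact: (continuous_closedP _).1 cRe _ (@closed_ge _ _).
apply/seteqP; split => v /=; rewrite lecE.
  by move=> /andP[/eqP <- ?]; split.
by move=> [-> ->]; rewrite eqxx.
Qed.

(** Extreme value theorem on the coordinates of [S] lying in the box [-1, 1]; the entry bound
    ensures that the box represents all of [S]. *)
Lemma mxtrace_max p (S : set 'M[C]_p) :
  S !=set0 -> (forall w, S w -> forall x y, `|w x y| <= 1) ->
  closed (@mx_of_coords p @^-1` S) ->
  exists2 w, S w & forall w', S w' -> complex.Re (\tr w') <= complex.Re (\tr w).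
Proof.
move=> [w0 Sw0] Sle1 Scl.
pose box := [set v : 'rV[R]_#|{: coord p}| | forall k, `[-1, 1]%classic (v ord0 k)].
pose A := (@mx_of_coords p @^-1` S) `&` box.
have Aonto w : S w -> exists2 v, A v & mx_of_coords v = w.
  move=> Sw; have [v vw v1] := mx_of_coords_onto (Sle1 w Sw).
  by exists v => //; split=> [|k]; rewrite /preimage /= ?vw // in_itv /= -ler_norml.
have cbox : compact box.
  apply: (@rV_compact R #|{: coord p}| (fun=> `[(-1 : R), 1]%classic)) => _.
  exact: segment_compact.
have cA : compact A by rewrite /A setIC; exact: compact_closedI.
have A0 : A !=set0 by have [v Av _] := Aonto _ Sw0; exists v.
have [v /set_mem[Sv _] vmax] :
    exists2 v, v \in A & forall u, u \in A ->
      complex.Re (\tr (mx_of_coords u)) <= complex.Re (\tr (mx_of_coords v)).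
  apply: compact_EVT_max => //; apply: continuous_subspaceT.
  have [cRe _] := continuous_mxtrace (1%:M : 'M[C]_p).
  by under [X in continuous X]funext do rewrite -[mx_of_coords _]mul1mx.
exists (mx_of_coords v) => // w' /Aonto[u Au <-].
by apply: vmax; rewrite inE.
Qed.
End Compactness.

(** * The semidefinite program and the attainment of its maximum *)

Section Feasible.
Variable R : realType.
Notation C := R[i].

(* The trace of w is the weight of the extendible component: a decomposition
   with weight lam and extension w_ext of sig_ext gives w = lam w_ext, and
   rho - ptrace_E w is the other component. *)
Definition feasible m n (rho : 'M[C]_(m * n)) (w : 'M[C]_(m * n * n)) :=
  [/\ psdmx w, swap_inv w & psdmx (rho - ptrace_E w)].

Lemma feasible0 m n (rho : 'M[C]_(m * n)) : psdmx rho -> feasible rho 0.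
Proof.
move=> rho0; split; first exact: psdmx0.
  by rewrite /swap_inv mulmx0 mul0mx.
by rewrite ptrace_E0 subr0.
Qed.

Lemma feasible_trace_le m n (rho : 'M[C]_(m * n)) w :
  feasible rho w -> \tr w <= \tr rho.
Proof.
move=> [_ _ /psdmx_trace_ge0].
by rewrite raddfB /= mxtrace_ptrace_E subr_ge0.
Qed.

Lemma feasibleZ m n (c : C) (rho : 'M[C]_(m * n)) w :
  0 <= c -> feasible rho w -> feasible (c *: rho) (c *: w).
Proof.
move=> c0 [w0 sw d0]; split; first exact: psdmxZ.
  exact: swap_invZ.
by rewrite ptrace_EZ -scalerBr; exact: psdmxZ.
Qed.

Lemma feasible_sum (I : finType) m n (rho : I -> 'M[C]_(m * n)) w :
  (forall i, feasible (rho i) (w i)) -> feasible (\sum_i rho i) (\sum_i w i).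
Proof.
move=> f; split; first by apply: psdmx_sum => i; have [] := f i.
  by apply: swap_inv_sum => i; have [] := f i.
by rewrite ptrace_E_sum -sumrB; apply: psdmx_sum => i; have [] := f i.
Qed.

Lemma feasible_max m n (rho : 'M[C]_(m * n)) : is_state rho ->
  exists2 w, feasible rho w &
    forall w', feasible rho w' -> complex.Re (\tr w') <= complex.Re (\tr w).
Proof.
move=> [rho0 trho].
apply: (@mxtrace_max R _ [set w | feasible rho w]).
- by exists 0; exact: feasible0.
- move=> w fw x y; have [w0 _ _] := fw.
  by apply: le_trans (psdmx_norm_le_trace x y w0) _; rewrite -trho feasible_trace_le.
(* Feasibility as trace inequalities: [T1] tests positivity, [T2] with both signs tests swap
   invariance entry by entry, [T3] with bound [c3] tests positivity of the remainder. *)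
pose T1 (v : 'cV[C]_(m * n * n)) := v *m adjmx v.
pose T2 (xy : 'I_(m * n * n) * 'I_(m * n * n)) : 'M[C]_(m * n * n) :=
  delta_mx (swap_index xy.2) (swap_index xy.1) - delta_mx xy.2 xy.1.
pose T3 (v : 'cV[C]_(m * n)) := - ((v *m adjmx v) *t (1%:M : 'M[C]_n)).
pose c3 (v : 'cV[C]_(m * n)) := - \tr (v *m adjmx v *m rho).
have -> : (@mx_of_coords R _ @^-1` [set w | feasible rho w] =
    (\bigcap_(v in setT) [set u | 0 <= \tr (T1 v *m mx_of_coords u)]) `&`
    ((\bigcap_(xy in setT) [set u | 0 <= \tr (T2 xy *m mx_of_coords u)]) `&`
     (\bigcap_(xy in setT) [set u | 0 <= \tr (- T2 xy *m mx_of_coords u)]) `&`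
     (\bigcap_(v in setT) [set u | c3 v <= \tr (T3 v *m mx_of_coords u)])))%classic.
  have T2E xy w : \tr (T2 xy *m w) = w (swap_index xy.1) (swap_index xy.2) - w xy.1 xy.2.
    by rewrite mulmxBl raddfB /= !mxtrace_delta_mul.
  have c3E v w : (c3 v <= \tr (T3 v *m w)) =
      (0 <= \tr (v *m adjmx v *m (rho - ptrace_E w))).
    rewrite mulmxBr raddfB /= ptrace_E_adjoint mulNmx raddfN /= subr_ge0.
    by rewrite lerN2.
  apply/seteqP; split => u.
    move=> [/psdmxP w0 /swap_invP sw /psdmxP d0]; split=> [v _|]; first exact: w0.
    split; [split|] => [xy _|xy _|v _] /=.
    - by rewrite T2E sw subrr.
    - by rewrite mulNmx raddfN /= T2E sw subrr oppr0.
    - by rewrite c3E.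
  move=> [w0 [[s1 s2] d0]]; split.
  - by apply/psdmxP => v; exact: w0.
  - apply/swap_invP => x y; apply/eqP; rewrite -subr_eq0 eq_le.
    rewrite -(T2E (x, y)) s1 // andbT -oppr_ge0.
    by have := s2 (x, y) I; rewrite /= mulNmx raddfN.
  - by apply/psdmxP => v; rewrite -c3E; exact: d0.
apply: closedI; first by apply: closed_bigI => v _; exact: closed_mxtrace_ge.
apply: closedI; last by apply: closed_bigI => v _; exact: closed_mxtrace_ge.
by apply: closedI; apply: closed_bigI => v _; exact: closed_mxtrace_ge.
Qed.

End Feasible.

(** * Identification of [lambda_max] with the optimal trace; convexity and separable states *)

Section LambdaMax.
Variable R : realType.
Notation C := R[i].

Lemma real_complex_Re (z : C) : 0 <= z -> z = (complex.Re z)%:C.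
Proof. by move=> /ger0_real z0; rewrite RRe_real. Qed.

Lemma is_state_normalize p (A : 'M[C]_p) : psdmx A -> \tr A != 0 ->
  is_state ((\tr A)^-1 *: A).
Proof.
move=> A0 tA; split; last by rewrite mxtraceZ mulVf.
by apply: psdmxZ => //; rewrite invr_ge0 psdmx_trace_ge0.
Qed.

Lemma is_state_convex (I : finType) p (c : I -> R) (A : I -> 'M[C]_p) :
  (forall i, 0 <= c i) -> \sum_i c i = 1 -> (forall i, is_state (A i)) ->
  is_state (\sum_i (c i)%:C *: A i).
Proof.
move=> c0 c1 sA; split.
  by apply: psdmx_sum => i; apply: psdmxZ; [rewrite ler0c | have [] := sA i].
rewrite raddf_sum /= (eq_bigr (fun i => (c i)%:C)) => [|i _].
  by rewrite -rmorph_sum c1.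
by have [_ ti] := sA i; rewrite mxtraceZ ti mulr1.
Qed.

Lemma sym_extendible_ptrace m n (w : 'M[C]_(m * n * n)) : is_state w -> swap_inv w ->
  is_state (ptrace_E w) /\ sym_extendible (ptrace_E w).
Proof.
move=> [w0 tw] sw; split.
  by split; [exact: psdmx_ptrace_E | rewrite mxtrace_ptrace_E].
by exists w; split => //; exact: ptrace_B_swap_inv.
Qed.

(** Normalising [w] gives the extension, unless its trace is zero. *)
Lemma extendible_part m n (w : 'M[C]_(m * n * n)) : (0 < m * n)%N ->
  psdmx w -> swap_inv w ->
  exists sig, [/\ is_state sig, sym_extendible sig & ptrace_E w = \tr w *: sig].
Proof.
move=> mn0 w0 sw; have [tw|tw] := eqVneq (\tr w) 0.
  rewrite tw (psdmx_trace0 w0 tw) ptrace_E0.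
  (* At weight zero any extendible state serves; the maximally mixed one is taken. *)
  have t1 : \tr (1%:M : 'M[C]_(m * n * n)) != 0.
    rewrite mxtrace1 pnatr_eq0 -lt0n muln_gt0 mn0.
    by move: mn0; rewrite muln_gt0 => /andP[].
  have [|se ee] := sym_extendible_ptrace (is_state_normalize (@psdmx1 R _) t1).
    apply/swap_invZ/swap_invP => x y.
    by rewrite !mxE (inj_eq (can_inj (@swap_indexK _ _))).
  by eexists; split; [exact: se | exact: ee | rewrite scale0r].
have [|se ee] := sym_extendible_ptrace (is_state_normalize w0 tw).
  exact: swap_invZ.
by eexists; split; [exact: se | exact: ee | rewrite ptrace_EZ scalerA mulfV ?scale1r].
Qed.

Lemma sym_decomposition_feasible m n (rho : 'M[C]_(m * n)) lam sig sig' :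
  sym_decomposition rho lam sig sig' ->
  exists2 w, feasible rho w & \tr w = lam%:C.
Proof.
move=> [/andP[l0 l1] [_ [w [[w0 tw] sw Ew _]]] [[s0 _] _] rhoE].
exists (lam%:C *: w); last by rewrite mxtraceZ tw mulr1.
split; [by apply: psdmxZ => //; rewrite ler0c | exact: swap_invZ |].
rewrite ptrace_EZ Ew rhoE addrAC subrr add0r.
by apply: psdmxZ => //; rewrite ler0c subr_ge0.
Qed.

Lemma sym_extendible_feasible m n (rho : 'M[C]_(m * n)) :
  sym_extendible rho -> exists2 w, feasible rho w & \tr w = 1.
Proof.
move=> [w [[w0 tw] sw Ew _]]; exists w => //; split => //.
by rewrite Ew subrr; exact: psdmx0.
Qed.

Lemma is_state_dim_gt0 p (rho : 'M[C]_p) : is_state rho -> (0 < p)%N.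
Proof.
case: p rho => // rho [_]; rewrite /mxtrace big_ord0 => /eqP.
by rewrite eq_sym oner_eq0.
Qed.

Lemma feasible_max_decomposition m n (rho : 'M[C]_(m * n)) w : is_state rho ->
  feasible rho w ->
  (forall w', feasible rho w' -> complex.Re (\tr w') <= complex.Re (\tr w)) ->
  exists sig_ext sig_next,
    best_sym_decomposition rho (complex.Re (\tr w)) sig_ext sig_next.
Proof.
move=> srho fw wmax; have [rho0 trho] := srho; have [w0 sw d0] := fw.
have twE := real_complex_Re (psdmx_trace_ge0 w0).
set t := complex.Re (\tr w) in wmax twE *.
have t0 : 0 <= t by rewrite -ler0c -twE psdmx_trace_ge0.
have t1 : t <= 1 by rewrite -lecR -twE rmorph1 -trho feasible_trace_le.
have [sig [ssig esig wsig]] := extendible_part (is_state_dim_gt0 srho) w0 sw.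
rewrite twE in wsig.
have td : \tr (rho - ptrace_E w) = (1 - t)%:C.
  by rewrite raddfB /= trho mxtrace_ptrace_E twE rmorphB.
suff [sig' dec] : exists sig', sym_decomposition rho t sig sig'.
  exists sig, sig'; split=> // lam s s' /sym_decomposition_feasible[w' /wmax].
  by move=> + tw'; rewrite tw'.
have [t_eq1|t_neq1] := eqVneq t 1.
  (* At weight 1 the remainder has trace zero, hence vanishes; [rho] merely fills the place of the
     second state. *)
  exists rho; split; rewrite ?t0 ?t1 // ?t_eq1 ?subrr ?scale0r ?addr0 ?eqxx //.
  rewrite t_eq1 subrr in td.
  by apply/eqP; rewrite -subr_eq0 -t_eq1 -wsig (psdmx_trace0 d0).
have td0 : (1 - t)%:C != 0 by rewrite (inj_eq (@complexI R)) subr_eq0 eq_sym.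
exists ((1 - t)%:C^-1 *: (rho - ptrace_E w)).
have srest : is_state ((1 - t)%:C^-1 *: (rho - ptrace_E w)).
  by rewrite -td; apply: is_state_normalize => //; rewrite td.
split; rewrite ?t0 ?t1 //; last first.
  by rewrite scalerA mulfV // scale1r -wsig addrC subrK.
split=> // _ /sym_extendible_feasible[w' fw' tw'].
(* An extension [w'] of the normalised remainder would raise the trace to t + (1 - t) = 1, against
   maximality since t is not 1. *)
have : feasible rho (w + (1 - t)%:C *: w').
  split; first by apply: psdmxD => //; apply: psdmxZ; [rewrite ler0c subr_ge0 | case: fw'].
    by apply: swap_invD => //; apply: swap_invZ; case: fw'.
  have [_ _ /(psdmxZ (_ : 0 <= (1 - t)%:C))] := fw'.
  rewrite ler0c subr_ge0 => /(_ t1).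
  rewrite scalerBr scalerA (mulfV td0) scale1r.
  rewrite ptrace_ED ptrace_EZ opprD.
  by rewrite (addrA rho).
move=> /wmax; rewrite raddfD /= mxtraceZ tw' mulr1 twE -rmorphD /= addrC subrK.
by move=> t1'; move/eqP: t_neq1; apply; apply/eqP; rewrite eq_le t1 t1'.
Qed.

Lemma lambda_max_best m n (rho : 'M[C]_(m * n)) lam sig sig' :
  best_sym_decomposition rho lam sig sig' -> lambda_max rho = lam.
Proof.
move=> [dec best]; apply/eqP; rewrite eq_le; apply/andP; split.
  by apply: ge_sup; [exists lam, sig, sig' | move=> l [s [s' /best]]].
apply: ub_le_sup; last by exists sig, sig'.
by exists lam => l [s [s' /best]].
Qed.

(** With [feasible_le_lambda_max], this turns the supremum over decompositions into an attained
    maximum of traces; bounds on [Ess] then follow by exhibiting feasible matrices. *)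
Lemma lambda_max_feasible m n (rho : 'M[C]_(m * n)) : is_state rho ->
  exists2 w, feasible rho w & \tr w = (lambda_max rho)%:C.
Proof.
move=> srho; have [w fw wmax] := feasible_max srho.
have [s [s' /lambda_max_best ->]] := feasible_max_decomposition srho fw wmax.
by exists w => //; apply: real_complex_Re; apply: psdmx_trace_ge0; case: fw.
Qed.

Lemma feasible_le_lambda_max m n (rho : 'M[C]_(m * n)) w : is_state rho ->
  feasible rho w -> \tr w <= (lambda_max rho)%:C.
Proof.
move=> srho fw; have [v fv vmax] := feasible_max srho.
have [s [s' /lambda_max_best ->]] := feasible_max_decomposition srho fv vmax.
rewrite (real_complex_Re (psdmx_trace_ge0 _)) ?lecR; last by case: fw.
exact: vmax.
Qed.

Lemma lambda_max_le1 m n (rho : 'M[C]_(m * n)) : is_state rho -> lambda_max rho <= 1.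
Proof.
move=> srho; have [w /feasible_trace_le] := lambda_max_feasible srho.
by have [_ ->] := srho => + tw; rewrite tw lecR.
Qed.

Lemma best_sym_decomposition_exists m n (rho : 'M[C]_(m * n)) : is_state rho ->
  exists sig_ext sig_next,
    best_sym_decomposition rho (lambda_max rho) sig_ext sig_next.
Proof.
move=> srho; have [w fw wmax] := feasible_max srho.
have [s [s' best]] := feasible_max_decomposition srho fw wmax.
by exists s, s'; rewrite (lambda_max_best best).
Qed.

(** Homogeneity of the program: dividing [X] and [w] by the trace of [X] reduces to a state. This is
    the form needed for unnormalised outcomes. *)
Lemma weighted_lambda_max m n (X : 'M[C]_(m * n)) w : feasible X w ->
  psdmx X -> \tr X != 0 -> \tr w <= \tr X * (lambda_max ((\tr X)^-1 *: X))%:C.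
Proof.
move=> fw X0 tX; have tX0 : 0 <= (\tr X)^-1 by rewrite invr_ge0 psdmx_trace_ge0.
have := feasible_le_lambda_max (is_state_normalize X0 tX) (feasibleZ tX0 fw).
rewrite mxtraceZ mulrC ler_pdivrMr 1?mulrC // lt_def tX.
exact: psdmx_trace_ge0.
Qed.

(** Equivalently [lambda_max] is concave: the mixture of optimal [w k] is feasible for the mixed
    state. *)
Lemma Ess_convex m n (I : finType) (p : I -> R) (rho : I -> 'M[C]_(m * n)) :
  (forall k, 0 <= p k) -> \sum_k p k = 1 -> (forall k, is_state (rho k)) ->
  Ess (\sum_k (p k)%:C *: rho k) <= \sum_k p k * Ess (rho k).
Proof.
move=> p0 p1 srho.
have /choice[w wP] : forall k, exists w,
    feasible (rho k) w /\ \tr w = (lambda_max (rho k))%:C.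
  by move=> k; have [w] := lambda_max_feasible (srho k); exists w.
have -> : \sum_k p k * Ess (rho k) = 1 - \sum_k p k * lambda_max (rho k).
  by rewrite -p1 -sumrB; apply: eq_bigr => k _; rewrite mulrBr mulr1.
rewrite lerD2l lerN2 -lecR.
have fw : feasible (\sum_k (p k)%:C *: rho k) (\sum_k (p k)%:C *: w k).
  by apply: feasible_sum => k; apply: feasibleZ (wP k).1; rewrite ler0c.
apply: le_trans (feasible_le_lambda_max (is_state_convex p0 p1 srho) fw).
rewrite ?raddf_sum /= ?raddf_sum /=; apply: ler_sum => k _.
by rewrite mxtraceZ (wP k).2 rmorphM.
Qed.

Lemma Ess_separable m n (rho : 'M[C]_(m * n)) : separable rho -> Ess rho = 0.
Proof.
move=> [N [p [al [be [p0 p1 sal sbe rhoE]]]]].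
have st a b (A : 'M[C]_a) (B : 'M[C]_b) : is_state A -> is_state B -> is_state (A *t B).
  move=> [A0 tA] [B0 tB]; split; first exact: psdmx_tens.
  by rewrite mxtrace_tens tA tB mulr1.
(* Repeating [be k] on E makes every term swap-invariant, and tracing out the copy returns [rho]. *)
pose w := \sum_k (p k)%:C *: (al k *t be k *t be k).
have [srho erho] : is_state (ptrace_E w) /\ sym_extendible (ptrace_E w).
  apply: sym_extendible_ptrace.
    by apply: is_state_convex => // k; exact: st (st _ _ _ _ (sal k) (sbe k)) (sbe k).
  apply: swap_inv_sum => k; apply/swap_invZ/swap_invP => x y.
  case: (triple_indexP x) => a b e; case: (triple_indexP y) => a' b' e'.
  by rewrite !swap_indexE !tensmxE mulrAC.
have wrho : ptrace_E w = rho.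
  rewrite ptrace_E_sum rhoE; apply: eq_bigr => k _.
  by rewrite ptrace_EZ ptrace_E_tens (sbe k).2 scale1r.
rewrite wrho in srho erho; have [v fv tv] := sym_extendible_feasible erho.
apply/eqP; rewrite subr_eq0 eq_le lambda_max_le1 // andbT.
by rewrite -lecR rmorph1 -tv feasible_le_lambda_max.
Qed.

End LambdaMax.

(** * Monotonicity under one-way protocols *)

Section LOCC.
Variable R : realType.
Notation C := R[i].
Variables (m n m' n' N r s : nat).
Variables (KA : 'I_N -> 'I_r -> 'M[C]_(m', m)) (KB : 'I_N -> 'I_s -> 'M[C]_(n', n)).
Hypothesis locc : one_way_LOCC KA KB.

Notation out := (unnormalized_output KA KB).

Lemma outputB X Y i : out (X - Y) i = out X i - out Y i.
Proof.
rewrite /unnormalized_output -sumrB; apply: eq_bigr => k _.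
by rewrite -sumrB; apply: eq_bigr => l _; rewrite mulmxBr mulmxBl.
Qed.

Lemma psdmx_output X i : psdmx X -> psdmx (out X i).
Proof. by move=> X0; do 2 apply: psdmx_sum => ?; exact: psdmx_congr. Qed.

(** Trace preservation by both completeness relations: B's holds for each message separately, A's
    only after summing over messages. *)
Lemma mxtrace_output X : \sum_i \tr (out X i) = \tr X.
Proof.
have [A1 B1] := locc.
rewrite -[X in RHS]mul1mx -tensmx11 -A1 tensmx_suml mulmx_suml raddf_sum /=.
apply: eq_bigr => i _; rewrite tensmx_suml mulmx_suml !raddf_sum /=.
apply: eq_bigr => k _; rewrite -(B1 i) tensmx_sumr mulmx_suml !raddf_sum /=.
apply: eq_bigr => l _.
by rewrite mxtrace_mulC !mulmxA adjmx_tens tensmx_mul.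
Qed.

(* Both copies B and E of the receiver's system are processed according to the
   message i, which only A can produce: this is where one-way communication
   is needed. *)
Definition extension_output (w : 'M[C]_(m * n * n)) i : 'M[C]_(m' * n' * n') :=
  \sum_k \sum_l \sum_l'
    (KA i k *t KB i l *t KB i l') *m w *m adjmx (KA i k *t KB i l *t KB i l').

Lemma ptrace_E_extension_output w i :
  ptrace_E (extension_output w i) = out (ptrace_E w) i.
Proof.
rewrite ptrace_E_sum; apply: eq_bigr => k _.
rewrite ptrace_E_sum; apply: eq_bigr => l _.
by rewrite ptrace_E_sum ptrace_E_kraus //; exact: locc.2.
Qed.

(** By linearity the new remainder is the output of the old one, so positivity passes through the
    Kraus maps. *)
Lemma feasible_output rho w i :
  feasible rho w -> feasible (out rho i) (extension_output w i).
Proof.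
move=> [w0 sw d0]; split.
- by do 3 apply: psdmx_sum => ?; exact: psdmx_congr.
- by apply: swap_inv_sum => k; exact: swap_inv_kraus.
- by rewrite ptrace_E_extension_output -outputB; exact: psdmx_output.
Qed.

Lemma outcome_probE X i : psdmx X -> \tr (out X i) = (outcome_prob KA KB X i)%:C.
Proof. by move=> X0; apply/real_complex_Re/psdmx_trace_ge0/psdmx_output. Qed.

Lemma Ess_one_way_LOCC rho : is_state rho ->
  \sum_i outcome_prob KA KB rho i * Ess (outcome_state KA KB rho i) <= Ess rho.
Proof.
move=> srho; have [rho0 trho] := srho.
have pE i := outcome_probE i rho0; set p := outcome_prob KA KB rho in pE *.
have p1 : \sum_i p i = 1.
  apply: (@complexI R); rewrite rmorph1 -trho -mxtrace_output raddf_sum /=.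
  by apply: eq_bigr => i _; rewrite pE.
have -> : \sum_i p i * Ess (outcome_state KA KB rho i) =
    1 - \sum_i p i * lambda_max (outcome_state KA KB rho i).
  by rewrite -p1 -sumrB; apply: eq_bigr => i _; rewrite mulrBr mulr1.
rewrite lerD2l lerN2 -lecR.
have [w fw <-] := lambda_max_feasible srho.
(* The optimal weight splits as the sum of the traces of the extension outputs, so a comparison
   outcome by outcome suffices. *)
rewrite -mxtrace_ptrace_E -mxtrace_output raddf_sum /=; apply: ler_sum => i _.
rewrite -ptrace_E_extension_output mxtrace_ptrace_E.
have fi := feasible_output i fw; rewrite rmorphM /= -pE.
(* For a null outcome [outcome_state] is a junk value and cannot be normalised; there feasibility
   bounds the trace of the extension output by 0. *)
have [t0|t0] := eqVneq (\tr (out rho i)) 0.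
  by rewrite t0 mul0r -t0; exact: feasible_trace_le.
have -> : outcome_state KA KB rho i = (\tr (out rho i))^-1 *: out rho i.
  by rewrite pE -fmorphV.
exact: weighted_lambda_max (psdmx_output i rho0) t0.
Qed.

End LOCC.

(** * Invariance under local unitaries *)

Section LocalUnitary.
Variable R : realType.
Notation C := R[i].

Lemma adjmx_unitary p (U : 'M[C]_p) : U \is unitarymx -> adjmx U *m U = 1%:M.
Proof. by move/unitarymxP/mulmx1C. Qed.

Lemma unitary_conj_state m n (rho : 'M[C]_(m * n)) (U : 'M[C]_m)
    (V : 'M[C]_n) :
  is_state rho -> U \is unitarymx -> V \is unitarymx ->
  is_state ((U *t V) *m rho *m adjmx (U *t V)).
Proof.
move=> [rho0 trho] Uu Vu; split; first exact: psdmx_congr.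
rewrite mxtrace_mulC mulmxA adjmx_tens tensmx_mul !adjmx_unitary //.
by rewrite tensmx11 mul1mx.
Qed.

Lemma Ess_unitary_le m n (rho : 'M[C]_(m * n)) (U : 'M[C]_m)
    (V : 'M[C]_n) :
  is_state rho -> U \is unitarymx -> V \is unitarymx ->
  Ess ((U *t V) *m rho *m adjmx (U *t V)) <= Ess rho.
Proof.
move=> srho Uu Vu.
(* A single message and a single Kraus operator on each side; the outcome has probability 1. *)
pose KA (_ _ : 'I_1) := U; pose KB (_ _ : 'I_1) := V.
have locc : one_way_LOCC KA KB.
  by split=> [|i]; rewrite !big_ord1 adjmx_unitary.
have := Ess_one_way_LOCC locc srho; rewrite big_ord1.
have outE : unnormalized_output KA KB rho ord0 = (U *t V) *m rho *m adjmx (U *t V).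
  by rewrite /unnormalized_output !big_ord1.
rewrite /outcome_state /outcome_prob outE (unitary_conj_state srho Uu Vu).2.
by rewrite invr1 scale1r mul1r.
Qed.

Lemma Ess_unitary m n (rho : 'M[C]_(m * n)) (U : 'M[C]_m)
    (V : 'M[C]_n) :
  is_state rho -> U \is unitarymx -> V \is unitarymx ->
  Ess ((U *t V) *m rho *m adjmx (U *t V)) = Ess rho.
Proof.
move=> srho Uu Vu; apply/eqP; rewrite eq_le Ess_unitary_le //=.
have adj_unitary p (W : 'M[C]_p) : W \is unitarymx -> adjmx W \is unitarymx.
  by rewrite trmxC_unitary.
(* Conjugation by the adjoints restores [rho], which gives the reverse inequality. *)
have := Ess_unitary_le (unitary_conj_state srho Uu Vu)
  (adj_unitary _ _ Uu) (adj_unitary _ _ Vu).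
rewrite !mulmxA tensmx_mul !adjmx_unitary // tensmx11 mul1mx.
by rewrite -mulmxA -adjmxM tensmx_mul !adjmx_unitary // tensmx11 adjmx1 mulmx1.
Qed.

End LocalUnitary.

Theorem mainTheorem1 (R : realType) :
  (forall (m n : nat) (rho : 'M[R[i]]_(m * n)), is_state rho ->
     exists sig_ext sig_next : 'M[R[i]]_(m * n),
       best_sym_decomposition rho (lambda_max rho) sig_ext sig_next) /\
  one_way_entanglement_monotone (fun m n : nat => @Ess R m n).
Proof.
split=> [m n rho|]; first exact: best_sym_decomposition_exists.
split=> [m n rho srho|m n rho||m n m' n' N r s KA KB rho srho locc|m n N p rho].
- by rewrite subr_ge0 lambda_max_le1.
- exact: Ess_separable.
- by move=> m n rho U V srho Uu Vu; exact: Ess_unitary.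
- exact: Ess_one_way_LOCC.
- exact: Ess_convex.
Qed.
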